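(* Consider $\mathbb R^{2n}$ with its canonical symplectic form $\omega_0$ as a symplectic manifold, and let $X_H=J\nabla H$ be the Hamiltonian vector field of a differentiable Hamiltonian function $H$. Let $U\subset\mathbb R^{2n}$ be a convex open set and $z_k,z_{k+1}\in U$ two interior points. Consider a point $\bar z\in U$ and a differentiable map $f:U\times U\to U$ such that $\bar z=f(z_k,z_{k+1})$. Denote the matrices of partial derivatives by $$B=\frac{\partial f(z_k,z_{k+1})}{\partial z_k}\qquad\text{and}\qquad C=\frac{\partial f(z_k,z_{k+1})}{\partial z_{k+1}},$$ and suppose that $B$ and $C$ fulfill the conditions $$\text{(i)}\quad B+C=I_{2n}\qquad\text{and}\qquad\text{(ii)}\quad BJ=JC^T,$$ where $I_{2n}$ is the $2n\times 2n$ identity matrix. Then the map $$z_{k+1}=z_k+h\,X_H(\bar z)$$ defines an implicit symplectic integrator with stepsize $h$.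
   Context: $J$ is the $2n\times 2n$ matrix $J=\begin{pmatrix}0_n&-I_n\\ I_n&0_n\end{pmatrix}$ and $\nabla$ is the standard gradient operator on $\mathbb R^{2n}$. An implicit symplectic integrator is a map $\varphi_h:U\times U\to U$, $(z_k,z_{k+1})\mapsto z_{k+1}=\varphi_h(z_k,z_{k+1})$, smooth with respect to $h$ and $H$, and symplectic in the following sense. Write the scheme as the implicit rule $\Psi(z_{k+1},z_k)=z_{k+1}-\varphi_h(z_{k+1},z_k)=0$; for the map in the claim this is $z_{k+1}-z_k-hX_H(f(z_k,z_{k+1}))=0$. Implicit differentiation gives the linearized algorithm $\delta z_{k+1}=A\,\delta z_k$ with $A=A_1^{-1}A_2$ (the linearized amplification matrix), where $$A_1=\frac{\partial\Psi(z_{k+1},z_k)}{\partial z_{k+1}},\qquad A_2=-\frac{\partial\Psi(z_{k+1},z_k)}{\partial z_k}.$$ The implicit rule is symplectic if $A_2^TA_1^{-T}JA_1^{-1}A_2=J$, i.e. $A^TJA=J$.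
   Formalization: H is taken twice differentiable on U, so that the linearized algorithm exists, and the step is shown to stay in U only locally near each pair and for small h, since for fixed h it can leave U; symplecticity is shown for every h with A_1 invertible, including all small h. *)

(* Defs.v *)
From HB Require Import structures.
From mathcomp Require Import all_boot all_order all_algebra.
From mathcomp Require Import all_classical all_reals all_analysis.
Set Implicit Arguments.
Unset Strict Implicit.
Unset Printing Implicit Defensive.
Import Order.TTheory GRing.Theory Num.Theory.
Import numFieldNormedType.Exports.
Local Open Scope classical_set_scope.
Local Open Scope ring_scope.

Definition symplJ (R : realType) (n : nat) : 'M[R]_(n + n) :=
  block_mx 0 (- 1%:M) 1%:M 0.

Definition gradient (R : realType) (m : nat) (H : 'cV[R]_m -> R)
    (z : 'cV[R]_m) : 'cV[R]_m :=
  \col_i 'D_(delta_mx i 0) H z.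

(* Column convention, so that it acts on column vectors from the left; the
   library's ['J f p] is its transpose, for row vectors. *)
Definition partial_mx (R : realType) (m p : nat) (g : 'cV[R]_m -> 'cV[R]_p)
    (z : 'cV[R]_m) : 'M[R]_(p, m) :=
  \matrix_(i, j) ('D_(delta_mx j 0) g z) i 0.

(* X_H must be differentiable for the linearized algorithm to make sense, so
   a Hamiltonian is twice (Frechet) differentiable on U; its values outside the
   open set U are irrelevant. *)
Definition hamiltonian (R : realType) (m : nat) (U : set 'cV[R]_m)
    (H : 'cV[R]_m -> R) : Prop :=
  forall z, U z -> differentiable H z /\ differentiable (gradient H) z.

Definition ham_vf (R : realType) (n : nat) (H : 'cV[R]_(n + n) -> R)
    (z : 'cV[R]_(n + n)) : 'cV[R]_(n + n) :=
  symplJ R n *m gradient H z.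

(* C^k on the whole space, by iterated directional derivatives. This is the
   usual notion when V is finite dimensional. *)
Fixpoint Ck (R : realType) (V W : normedModType R) (k : nat) (g : V -> W)
    : Prop :=
  if k is k'.+1 then
    (forall x, differentiable g x) /\ (forall v, Ck k' (fun x => 'D_v g x))
  else continuous g.

Definition smooth (R : realType) (V W : normedModType R) (g : V -> W) : Prop :=
  forall k, Ck k g.

(* A scheme assigns to a Hamiltonian H and a stepsize h the map
   (z_k, z_{k+1}) |-> phi H h (z_k, z_{k+1}). *)
Definition scheme (R : realType) (m : nat) : Type :=
  ('cV[R]_m -> R) -> R -> 'cV[R]_m * 'cV[R]_m -> 'cV[R]_m.

(* Smoothness with respect to the stepsize and the Hamiltonian, jointly.
   Smooth dependence on the function H is smoothness along every
   finite-dimensional affine family H + t_0 K_0 + ... + t_(m-1) K_(m-1). *)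
Definition smooth_in_step_and_ham (R : realType) (d : nat) (U : set 'cV[R]_d)
    (phi : scheme R d) (H : 'cV[R]_d -> R) : Prop :=
  forall (m : nat) (K : 'I_m -> 'cV[R]_d -> R),
    (forall i, hamiltonian U (K i)) ->
  forall x y, U x -> U y ->
    smooth (fun p : R * 'rV[R]_m =>
      phi (fun z => H z + \sum_(i < m) p.2 0 i * K i z) p.1 (x, y)).

(* The step maps U x U to U, locally and for small stepsizes: for a fixed h
   nothing prevents a step from leaving U. *)
Definition valued_in (R : realType) (d : nat) (U : set 'cV[R]_d)
    (phi : R -> 'cV[R]_d * 'cV[R]_d -> 'cV[R]_d) : Prop :=
  forall x y, U x -> U y ->
    \forall h \near (0 : R) & p \near (x, y), U (phi h p).

(* Psi (z_{k+1}, z_k), whose zero set is the implicit rule *)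
Definition implicit_rule (R : realType) (d : nat)
    (phi : 'cV[R]_d * 'cV[R]_d -> 'cV[R]_d) (p : 'cV[R]_d * 'cV[R]_d)
    : 'cV[R]_d :=
  p.1 - phi (p.2, p.1).

Section LinearizedRule.
Variables (R : realType) (d : nat) (Psi : 'cV[R]_d * 'cV[R]_d -> 'cV[R]_d).
Variables zk zk1 : 'cV[R]_d.

Definition rule_A1 : 'M[R]_d := partial_mx (fun w => Psi (w, zk)) zk1.

Definition rule_A2 : 'M[R]_d := - partial_mx (fun w => Psi (zk1, w)) zk.

Definition amplification_mx : 'M[R]_d := invmx rule_A1 *m rule_A2.

End LinearizedRule.

(* [invmx] is the identity outside [unitmx], whence the second condition. *)
Definition symplectic_rule (R : realType) (n : nat)
    (Psi : 'cV[R]_(n + n) * 'cV[R]_(n + n) -> 'cV[R]_(n + n))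
    (zk zk1 : 'cV[R]_(n + n)) : Prop :=
  let A := amplification_mx Psi zk zk1 in
  [/\ differentiable Psi (zk1, zk),
      rule_A1 Psi zk zk1 \in unitmx
    & A^T *m symplJ R n *m A = symplJ R n].

(* Symplecticity is asked at the given pair (z_k, z_{k+1}), for every stepsize
   for which the linearized algorithm is defined, which must include all
   sufficiently small ones. *)
Definition implicit_symplectic_integrator (R : realType) (n : nat)
    (U : set 'cV[R]_(n + n)) (phi : scheme R (n + n)) (H : 'cV[R]_(n + n) -> R)
    (zk zk1 : 'cV[R]_(n + n)) : Prop :=
  [/\ smooth_in_step_and_ham U phi H,
      valued_in U (phi H),
      \forall h \near (0 : R),
        symplectic_rule (implicit_rule (phi H h)) zk zk1
    & forall h : R, rule_A1 (implicit_rule (phi H h)) zk zk1 \in unitmx ->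
        symplectic_rule (implicit_rule (phi H h)) zk zk1].

(* Main.v *)
Require Import Defs.
From HB Require Import structures.
From mathcomp Require Import all_boot all_order all_algebra.
From mathcomp Require Import all_classical all_reals all_analysis.
From mathcomp Require Import ring.
Import Order.TTheory GRing.Theory Num.Theory.
Import numFieldNormedType.Exports.
Local Open Scope classical_set_scope.
Local Open Scope ring_scope.

(* With [S] the Hessian of [H] at [f (zk, zk1)], differentiating the rule gives
   [A1 = 1 - h J S C] and [A2 = 1 + h J S B].  Conditions (i) and (ii) yield
   [A1 J A1^T = A2 J A2^T] as soon as [S] is symmetric, so [A := A1^-1 A2]
   satisfies [A J A^T = J], which is equivalent to [A^T J A = J].  As [H] is
   only twice Frechet differentiable, the symmetry of [S] is Young's theorem: the
   second difference of [H] is symmetric in its two increments and, divided by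
   [s ^+ 2], tends to the iterated directional derivative. *)

(** * Symplectic linear algebra *)

Lemma trmx_symplJ (R : realType) (n : nat) : (symplJ R n)^T = - symplJ R n.
Proof.
by rewrite /symplJ tr_block_mx opp_block_mx !trmx0 linearN /= trmx1 opprK oppr0.
Qed.

Lemma symplJ_sqr (R : realType) (n : nat) : symplJ R n *m symplJ R n = - 1%:M.
Proof.
rewrite /symplJ mulmx_block !(mulmx0, mul0mx, mulmx1, mul1mx, addr0, add0r).
by rewrite (scalar_mx_block n n 1) opp_block_mx !oppr0.
Qed.

(** The hypotheses make [- (A^T *m J)] a right inverse of [A *m J]. For square matrices over a
    commutative ring it is then also a left inverse, and multiplying by [J] on the right gives the
    claim. *)
Lemma symplectic_trmx (R : comUnitRingType) (d : nat) (J A : 'M[R]_d) :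
  J *m J = - 1%:M -> A *m J *m A^T = J -> A^T *m J *m A = J.
Proof.
move=> JJ AJA.
have : (A *m J) *m - (A^T *m J) = 1%:M.
  by rewrite mulmxN !mulmxA AJA JJ opprK.
move=> /mulmx1C /(congr1 (mulmx^~ J)); rewrite mul1mx !mulNmx -!mulmxA JJ.
by rewrite !mulmxN mulmx1 opprK mulmxA.
Qed.

(** With [P := h J S] one has [A1 = A2 - P]. Expanding [A1 J A1^T] gives [A2 J A2^T] minus the cross
    terms [A2 J P^T + P J A2^T] plus [P J P^T], and the last two contributions cancel. *)
Lemma cayley_symplectic (R : comUnitRingType) (d : nat)
    (J S B C : 'M[R]_d) (h : R) :
  J^T = - J -> J *m J = - 1%:M -> S^T = S ->
  B + C = 1%:M -> B *m J = J *m C^T ->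
  let A1 := 1%:M - h *: (J *m S *m C) in
  let A2 := 1%:M + h *: (J *m S *m B) in
  A1 \in unitmx ->
  (invmx A1 *m A2)^T *m J *m (invmx A1 *m A2) = J.
Proof.
move=> JT JJ ST BC BJ A1 A2 A1u.
pose P := h *: (J *m S).
have A2E : A2 = 1%:M + P *m B by rewrite /P -scalemxAl.
have A1E : A1 = A2 - P.
  rewrite /A1.
  have -> : C = 1%:M - B by rewrite -BC addrC addKr.
  by rewrite A2E mulmxBr mulmx1 scalerBr opprB addrA /P -scalemxAl.
(* Symmetry of [S] puts [P] in the symplectic Lie algebra. *)
have JP : J *m P^T = - (P *m J).
  rewrite /P linearZ /= trmx_mul ST JT mulmxN scalerN mulmxN.
  by rewrite -scalemxAr -scalemxAl mulmxA.
(* Conditions (i) and (ii) enter the cross terms as [B J + J B^T = J]. *)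
have JB : J *m B^T = J - B *m J.
  by rewrite BJ -[X in X - _]mulmx1 -trmx1 -BC linearD /= mulmxDr addrK.
have cross : A2 *m J *m P^T + P *m J *m A2^T = P *m J *m P^T.
  rewrite A2E !linearD /= trmx1 trmx_mul !mulmxDl !mul1mx mulmx1 JP addrACA.
  rewrite addNr add0r -!mulmxA -mulmxDr [J *m (B^T *m _)]mulmxA JB.
  by rewrite mulmxA -mulmxDl addrC subrK.
have congJ : A1 *m J *m A1^T = A2 *m J *m A2^T.
  rewrite A1E [(A2 - P)^T]linearB /= mulmxBl mulmxBr !mulmxBl -cross.
  by rewrite opprB [A2 *m J *m P^T + _]addrC addrK subrK.
apply: symplectic_trmx => //.
rewrite trmx_mul -!mulmxA [J *m _]mulmxA [A2 *m _]mulmxA [A2 *m _]mulmxA -congJ.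
rewrite -!mulmxA -trmx_mul mulVmx // trmx1 mulmx1 mulKmx //.
Qed.

(** * Symmetry of second directional derivatives *)

Lemma is_derive_line (R : realType) (V : normedModType R) (H : V -> R)
    (w a : V) (u : R) : differentiable H (u *: a + w) ->
  is_derive u 1 (fun t : R => H (t *: a + w)) ('D_a H (u *: a + w)).
Proof.
move=> dH.
have E : (fun h : R =>
      h^-1 *: (H ((h *: (1 : R) + u) *: a + w) - H (u *: a + w)))
    = (fun h : R => h^-1 *: (H (h *: a + (u *: a + w)) - H (u *: a + w))).
  by apply/funext => h; rewrite [h *: 1]mulr1 scalerDl addrA.
have dl : derivable H (u *: a + w) a by exact: diff_derivable.
apply: DeriveDef; first by rewrite /derivable /= E.
by rewrite /derive /= E.
Qed.

Lemma diff_remainder (R : realType) (V W : normedModType R) (g : V -> W)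
    (z : V) :
  differentiable g z -> forall e : R, 0 < e ->
  \forall h \near 0, `|g (h + z) - g z - 'd g z h| <= e * `|h|.
Proof.
move=> dg e e0; have [_ gE] := (diff_locallyxP z g).1 dg.
set k := 'o _ in gE.
have lk := littleoP [littleo of k] e0.
near=> h; rewrite gE.
have -> : g z + 'd g z h + k h - g z - 'd g z h = k h.
  by rewrite -addrA -opprD [_ + k h]addrC addrK.
by near: h; exact: lk.
Unshelve. all: by end_near. Qed.

(* By the mean value theorem the second difference is [s] times an increment of
   ['D_a H] over [s *: b], and differentiability at the single point [z]
   controls that increment. *)
Lemma second_difference (R : realType) (V : normedModType R) (H : V -> R)
    (z a b : V) :
  (\forall w \near z, differentiable H w) -> differentiable ('D_a H) z ->
  forall e : R, 0 < e -> \forall s \near 0^'+,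
  `|H (s *: a + (s *: b + z)) - H (s *: a + z) - (H (s *: b + z) - H z)
    - s ^+ 2 * 'D_b ('D_a H) z| <= e * s ^+ 2.
Proof.
move=> nH dg e e0.
(* [s * M] bounds the norms of [c *: a] and [c *: a + s *: b] for [0 <= c <= s]; the summand 1 keeps
   [M] positive when [a] and [b] vanish. *)
set g := 'D_a H; set M := `|a| + `|b| + 1.
have M0 : 0 < M by rewrite ltr_wpDl // addr_ge0.
(* Two remainders of size at most [e / (2 * M) * (s * M)] add up to [e * s]; the mean value theorem
   supplies the other factor [s]. *)
have eta0 : 0 < e / (2 * M) by rewrite divr_gt0 // mulr_gt0.
have /nbhs_ballP[r1 /= r10 br1] := diff_remainder _ _ _ _ _ dg _ eta0.
have /nbhs_ballP[r2 /= r20 br2] := nH.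
have small1 (v : V) : `|v| < r1 ->
    `|g (v + z) - g z - 'd g z v| <= e / (2 * M) * `|v|.
  by move=> vr; apply: br1; rewrite -ball_normE /ball_ /= sub0r normrN.
have small2 (v : V) : `|v| < r2 -> differentiable H (v + z).
  move=> vr; apply: br2; rewrite -ball_normE /ball_ /=.
  by rewrite opprD addrCA subrr addr0 normrN.
near=> s.
have s0 : 0 < s by near: s; exact: nbhs_right_gt.
have sM1 : s * M < r1.
  by rewrite -ltr_pdivlMr //; near: s; apply: nbhs_right_lt; rewrite divr_gt0.
have sM2 : s * M < r2.
  by rewrite -ltr_pdivlMr //; near: s; apply: nbhs_right_lt; rewrite divr_gt0.
have bnd0 (c : R) : 0 <= c -> c <= s -> `|c *: a| <= s * M.
  move=> c0 cs; rewrite normrZ ger0_norm // ler_pM //.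
  by rewrite /M -addrA lerDl addr_ge0.
have bnd1 (c : R) : 0 <= c -> c <= s -> `|c *: a + s *: b| <= s * M.
  move=> c0 cs; apply: le_trans (ler_normD _ _) _.
  rewrite !normrZ (ger0_norm c0) (gtr0_norm s0) /M -addrA mulrDr lerD //.
    by rewrite ler_wpM2r.
  by rewrite ler_pM2l // lerDl.
(* The increment of [phi] from 0 to [s] is the second difference. *)
pose phi := (fun t : R => H (t *: a + (s *: b + z)))
  - (fun t : R => H (t *: a + z)).
have dphi (u : R) : 0 <= u -> u <= s ->
    is_derive u 1 phi (g (u *: a + (s *: b + z)) - g (u *: a + z)).
  move=> u0 us; apply: is_deriveB; apply: is_derive_line.
    by rewrite addrA; apply: small2; apply: le_lt_trans sM2; exact: bnd1.
  by apply: small2; apply: le_lt_trans sM2; exact: bnd0.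
have [| |c] := @MVT _ phi
  (fun u => g (u *: a + (s *: b + z)) - g (u *: a + z)) 0 s s0.
- by move=> u; rewrite in_itv => /andP[/ltW u0 /ltW us]; exact: dphi.
- apply: derivable_within_continuous => u; rewrite in_itv /= => /andP[u0 us].
  by have := dphi _ u0 us.
rewrite in_itv subr0 => /andP[/ltW c0 /ltW cs].
rewrite {1 2}/phi /= !fctE /= !scale0r !add0r => ->.
have -> : 'D_b g z = 'd g z b by exact: deriveE.
have n1 := small1 _ (le_lt_trans (bnd1 _ c0 cs) sM1).
have n0 := small1 _ (le_lt_trans (bnd0 _ c0 cs) sM1).
rewrite addrA.
set x := g (_ + _ + z) in n1 *; set y := g (_ + z) in n0 *.
(* The unknown intermediate value [c] drops out of the main term: by linearity the two differentials
   differ by [s * 'd g z b]. *)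
have -> : (x - y) * s - s ^+ 2 * 'd g z b
    = s * ((x - g z - 'd g z (c *: a + s *: b)) - (y - g z - 'd g z (c *: a))).
  have -> : 'd g z (c *: a + s *: b) = 'd g z (c *: a) + s * 'd g z b.
    by rewrite linearD [X in _ + X]linearZ.
  by ring.
rewrite normrM (gtr0_norm s0) expr2 mulrCA ler_pM2l //.
apply: le_trans (ler_normB _ _) _.
apply: le_trans (lerD n1 n0) _.
rewrite -mulrDr -mulrA ler_pM2l // ler_pdivrMl ?mulr_gt0 //.
rewrite -mulrA [leRHS]mulr_natl [leRHS]mulr2n [M * s]mulrC lerD ?bnd0 ?bnd1 //.
Unshelve. all: by end_near. Qed.

Lemma derive2C (R : realType) (V : normedModType R) (H : V -> R) (z a b : V) :
  (\forall w \near z, differentiable H w) ->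
  differentiable ('D_a H) z -> differentiable ('D_b H) z ->
  'D_b ('D_a H) z = 'D_a ('D_b H) z.
Proof.
move=> nH da db; apply/eqP; rewrite -subr_eq0 -normr_le0.
apply/ler_addgt0Pr => e e0; rewrite add0r.
have e20 : 0 < e / 2 by rewrite divr_gt0.
(* One [s] serves both orders of differentiation. Both estimates concern the same second difference,
   so the two derivatives differ by at most [e]. *)
have [s [s0 [h1 h2]]] := filter_ex (filterI (nbhs_right_gt (0 : R))
  (filterI (second_difference _ _ _ _ a b nH da _ e20)
           (second_difference _ _ _ _ b a nH db _ e20))).
rewrite /= in s0 h1 h2; have s20 : 0 < s ^+ 2 by rewrite exprn_gt0.
rewrite -(ler_pM2r s20) -[s ^+ 2 in leLHS]gtr0_norm // -normrM.
have := lerD h2 h1; rewrite -mulrDl -splitr; apply: le_trans.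
apply: le_trans (ler_normB _ _).
rewrite le_eqVlt; apply/orP; left; apply/eqP; congr (`|_|).
(* Exchanging the increments inside [H] makes both second differences use the same four values,
   which are then generalized for [ring]. *)
rewrite (addrCA (s *: b)); move: (H _) (H _) (H _) (H _).
move: ('D_b ('D_a H) z : R) ('D_a ('D_b H) z : R) => dab dba k11 k10 k01 k00.
by ring.
Qed.

(** * Closure properties of [Ck] *)

Lemma Ck_cst (R : realType) (V W : normedModType R) (k : nat) (c : W) :
  Ck k (fun _ : V => c).
Proof.
elim: k c => [|k IH] c; first exact: cst_continuous.
split=> [x|v]; first exact: differentiable_cst.
by under eq_fun do rewrite derive_cst; exact: IH.
Qed.

(** Serves the product rule, where the undifferentiated factors reappear at the lower order. *)
Lemma CkW (R : realType) (V W : normedModType R) (k : nat) (g : V -> W) :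
  Ck k.+1 g -> Ck k g.
Proof.
elim: k g => [|k IH] g [dg Dg].
  by move=> x; exact: differentiable_continuous.
by split=> // v; exact: IH (Dg v).
Qed.

Lemma CkD (R : realType) (V W : normedModType R) (k : nat) (f g : V -> W) :
  Ck k f -> Ck k g -> Ck k (fun x => f x + g x).
Proof.
elim: k f g => [|k IH] f g.
  by move=> cf cg x; apply: cvgD; [exact: cf|exact: cg].
move=> [df Df] [dg Dg]; split=> [x|v]; first exact: differentiableD.
rewrite (_ : (fun x => _) = fun x => 'D_v f x + 'D_v g x).
  exact: IH (Df v) (Dg v).
by apply/funext => x; rewrite deriveD //; exact: diff_derivable.
Qed.

Lemma CkM (R : realType) (V : normedModType R) (k : nat) (f g : V -> R) :
  Ck k f -> Ck k g -> Ck k (fun x => f x * g x).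
Proof.
elim: k f g => [|k IH] f g.
  by move=> cf cg x; apply: cvgM; [exact: cf|exact: cg].
move=> Cf Cg; have [df Df] := Cf; have [dg Dg] := Cg.
split=> [x|v]; first exact: differentiableM.
rewrite (_ : (fun x => _) = fun x => f x * 'D_v g x + g x * 'D_v f x).
  by apply: CkD; apply: IH; [exact: CkW|exact: Dg|exact: CkW|exact: Df].
by apply/funext => x; rewrite deriveM //; exact: diff_derivable.
Qed.

Lemma CkZl (R : realType) (V W : normedModType R) (k : nat) (f : V -> R)
    (c : W) :
  Ck k f -> Ck k (fun x => f x *: c).
Proof.
elim: k f => [|k IH] f; first by move=> cf x; apply: cvgZr_tmp; exact: cf.
move=> [df Df]; split=> [x|v]; first exact: differentiableZl.
rewrite (_ : (fun x => _) = fun x => 'D_v f x *: c); first exact: IH (Df v).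
apply/funext => x; rewrite !deriveE ?diffZl //; exact: differentiableZl.
Qed.

(** The directional derivatives are constant. Continuity is a hypothesis because [V] may be infinite
    dimensional. *)
Lemma Ck_linear (R : realType) (V W : normedModType R) (k : nat) (f : V -> W) :
  linear f -> continuous f -> Ck k f.
Proof.
move=> lf cf; pose fM := GRing.isLinear.Build _ _ _ _ f lf.
pose fL : {linear V -> W} := HB.pack f fM.
have df x : differentiable f x by exact: (@linear_differentiable _ _ _ fL).
case: k => [//|k]; split=> // v.
rewrite (_ : (fun x => _) = fun=> f v); first exact: Ck_cst.
by apply/funext => x; rewrite deriveE // (@diff_lin _ _ _ fL).
Qed.

Lemma Ck_sum (R : realType) (V W : normedModType R) (k m : nat)
    (f : 'I_m -> V -> W) :
  (forall i, Ck k (f i)) -> Ck k (fun x => \sum_(i < m) f i x).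
Proof.
elim: m f => [|m IH] f Cf.
  by under eq_fun do rewrite big_ord0; exact: Ck_cst.
under eq_fun do rewrite big_ord_recr /=.
by apply: CkD => //; apply: IH => i.
Qed.

(** * Jacobian matrices, gradients and Hessians *)

Lemma mulmx_differentiable (R : realType) (m p : nat) (M : 'M[R]_(p, m))
    (z : 'cV[R]_m) : differentiable (fun w : 'cV[R]_m => M *m w) z.
Proof.
(* The product is the combination of the columns of [M] weighted by the coordinates of [w], and
   coordinates are differentiable. *)
rewrite (_ : (fun w => _) =
    \sum_(j < m) (fun w : 'cV[R]_m => w j 0 *: col j M)).
  apply: differentiable_sum => j; apply: differentiableZl.
  exact: differentiable_coord.
apply/funext => w; rewrite fct_sumE; apply/colP => i; rewrite mxE summxE.
by apply: eq_bigr => j _; rewrite !mxE mulrC.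
Qed.

Lemma is_diff_mulmx (R : realType) (m p : nat) (M : 'M[R]_(p, m))
    (z : 'cV[R]_m) :
  is_diff z (fun w : 'cV[R]_m => M *m w) (fun w => M *m w).
Proof.
have dM := mulmx_differentiable _ _ _ M.
apply: DiffDef => //; apply: (@diff_lin _ _ _ (mulmx M)) => w.
exact: differentiable_continuous (dM w).
Qed.

(** Together with [partial_mx_is_diff], this passes between Jacobian matrices and differentials, so
    that Jacobians can be computed by the chain rule. *)
Lemma is_diff_partial_mx (R : realType) (m p : nat)
    (g : 'cV[R]_m -> 'cV[R]_p) (z : 'cV[R]_m) :
  differentiable g z -> is_diff z g (fun w => partial_mx g z *m w).
Proof.
move=> dg; apply: DiffDef => //; apply/funext => w.
rewrite {1}(matrix_sum_delta w) linear_sum /=; apply/colP => i.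
rewrite mxE summxE; apply: eq_bigr => j _.
by rewrite big_ord1 linearZ /= !mxE deriveE // mulrC.
Qed.

Lemma partial_mx_is_diff (R : realType) (m p : nat)
    (g : 'cV[R]_m -> 'cV[R]_p) (z : 'cV[R]_m) (M : 'M[R]_(p, m)) :
  is_diff z g (fun w => M *m w) -> partial_mx g z = M.
Proof.
move=> dg; apply/matrixP => i j; rewrite mxE deriveE ?diff_val.
  by rewrite -colE mxE.
exact: ex_diff.
Qed.

(** The entries are iterated directional derivatives along basis vectors, which [derive2C]
    exchanges; openness of [U] supplies differentiability of [H] around [z]. *)
Lemma hessian_sym (R : realType) (m : nat) (U : set 'cV[R]_m)
    (H : 'cV[R]_m -> R) (z : 'cV[R]_m) : open U -> hamiltonian U H -> U z ->
  (partial_mx (gradient H) z)^T = partial_mx (gradient H) z.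
Proof.
move=> oU hH Uz; have [_ dg] := hH z Uz.
have dgi i : differentiable ('D_(delta_mx i 0) H) z.
  rewrite (_ : 'D_(_) H = (fun w : 'cV[R]_m => w i 0) \o gradient H).
    by apply: differentiable_comp => //; exact: differentiable_coord.
  by apply/funext => w; rewrite /= mxE.
have pE i j : partial_mx (gradient H) z i j
    = 'D_(delta_mx j 0) ('D_(delta_mx i 0) H) z.
  rewrite mxE derive_mx; last exact: diff_derivable.
  rewrite mxE (_ : (fun w => gradient H w i 0) = 'D_(delta_mx i 0) H) //.
  by apply/funext => w; rewrite mxE.
apply/matrixP => i j; rewrite mxE !pE; apply: derive2C => //.
by apply: filterS (open_nbhs_nbhs (conj oU Uz)) => w /hH [].
Qed.

Lemma gradient_affine_family (R : realType) (d m : nat) (H : 'cV[R]_d -> R)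
    (K : 'I_m -> 'cV[R]_d -> R) (t : 'rV[R]_m) (z : 'cV[R]_d) :
  differentiable H z -> (forall i, differentiable (K i) z) ->
  gradient (fun w => H w + \sum_(i < m) t 0 i * K i w) z =
  gradient H z + \sum_(i < m) t 0 i *: gradient (K i) z.
Proof.
move=> dH dK; apply/colP => j; rewrite !mxE summxE.
have dtK i : differentiable (t 0 i *: K i) z by exact: differentiableZ.
rewrite (_ : (fun w => _) = H + \sum_(i < m) (t 0 i *: K i)); last first.
  by apply/funext => w; rewrite fctE /= fct_sumE.
rewrite deriveD; [|exact: diff_derivable|]; last first.
  by apply: derivable_sum => i; exact: diff_derivable.
rewrite derive_sum; last by move=> i; exact: diff_derivable.
congr (_ + _); apply: eq_bigr => i _; rewrite !mxE deriveZ //.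
exact: diff_derivable.
Qed.

(** The determinant is a polynomial in [h] with value 1 at 0, hence nonzero nearby by continuity. *)
Lemma unitmx_near0 (R : realType) (d : nat) (M : 'M[R]_d) :
  \forall h \near (0 : R), 1%:M - h *: M \in unitmx.
Proof.
pose p : {poly R} := \det (1%:M - 'X *: map_mx polyC M).
have pE h : p.[h] = \det (1%:M - h *: M).
  rewrite -horner_evalE -det_map_mx; congr (\det _); apply/matrixP => i j.
  rewrite !mxE rmorphB rmorphM /= /horner_eval hornerX hornerC; congr (_ - _).
  by rewrite -polyC_natr hornerC.
have p0 : p.[0] != 0 by rewrite pE scale0r subr0 det1 oner_neq0.
have nz : nbhs p.[0] [set x : R | x != 0].
  by apply: open_nbhs_nbhs; split=> //; exact: open_neq.
have np : \forall h \near (0 : R), p.[h] != 0 by exact: continuous_horner nz.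
by apply: filterS np => h; rewrite pE unitmxE unitfE.
Qed.

(** * The Hamiltonian vector field and the step map *)

Lemma ham_vf_differentiable (R : realType) (n : nat) (U : set 'cV[R]_(n + n))
    (H : 'cV[R]_(n + n) -> R) (z : 'cV[R]_(n + n)) :
  hamiltonian U H -> U z -> differentiable (ham_vf H) z.
Proof.
move=> hH Uz; have [_ dg] := hH z Uz.
exact: (differentiable_comp dg (mulmx_differentiable _ _ _ _ _)).
Qed.

(** For fixed [x] and [y] the point [f (x, y)] depends on neither the stepsize nor the family
    parameters, and the gradient is linear in the Hamiltonian. The step is therefore polynomial in
    stepsize and parameters. *)
Lemma ham_vf_step_smooth (R : realType) (n : nat) (U : set 'cV[R]_(n + n))
    (H : 'cV[R]_(n + n) -> R)
    (f : 'cV[R]_(n + n) * 'cV[R]_(n + n) -> 'cV[R]_(n + n)) :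
  hamiltonian U H -> (forall x y, U x -> U y -> U (f (x, y))) ->
  smooth_in_step_and_ham U (fun K h p => p.1 + h *: ham_vf K (f p)) H.
Proof.
move=> hH fU m K hK x y Ux Uy k; set z := f (x, y).
have Uz : U z by exact: fU.
rewrite (_ : (fun p => _) = fun p : R * 'rV[R]_m => x + (p.1 *: ham_vf H z +
    \sum_(i < m) (p.1 * p.2 0 i) *: ham_vf (K i) z)); last first.
  apply/funext => p /=; congr (_ + _); rewrite /ham_vf gradient_affine_family.
  - rewrite mulmxDr scalerDr mulmx_sumr scaler_sumr; congr (_ + _).
    by apply: eq_bigr => i _; rewrite -scalemxAr scalerA.
  - by have [] := hH z Uz.
  - by move=> i; have [] := hK i z Uz.
have C1 : Ck k (fun p : R * 'rV[R]_m => p.1).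
  by apply: Ck_linear => [a u v //|p]; exact: cvg_fst.
have C2 i : Ck k (fun p : R * 'rV[R]_m => p.2 0 i).
  apply: Ck_linear => [a u v|p]; first by rewrite /= !mxE.
  apply: (@continuous_comp _ _ _ snd (fun N : 'rV[R]_m => N 0 i)).
    exact: cvg_snd.
  exact: coord_continuous.
apply: CkD; first exact: Ck_cst.
apply: CkD; first exact: CkZl.
by apply: Ck_sum => i; apply: CkZl; exact: CkM.
Qed.

(** The step is jointly continuous at [(0, (x, y))], where its value [x] lies in the open set
    [U]. *)
Lemma ham_vf_step_valued_in (R : realType) (n : nat) (U : set 'cV[R]_(n + n))
    (H : 'cV[R]_(n + n) -> R)
    (f : 'cV[R]_(n + n) * 'cV[R]_(n + n) -> 'cV[R]_(n + n)) :
  open U -> hamiltonian U H -> (forall x y, U x -> U y -> U (f (x, y))) ->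
  (forall x y, U x -> U y -> differentiable f (x, y)) ->
  valued_in U (fun h p => p.1 + h *: ham_vf H (f p)).
Proof.
move=> oU hH fU df x y Ux Uy.
have cX : {for (x, y), continuous (ham_vf H \o f)}.
  apply: differentiable_continuous; apply: differentiable_comp; first exact: df.
  by apply: ham_vf_differentiable hH _; exact: fU.
pose q0 : R * ('cV[R]_(n + n) * 'cV[R]_(n + n)) := (0, (x, y)).
have c1 : {for q0, continuous (fun q => q.2.1)}.
  by apply: (@continuous_comp _ _ _ snd fst); [exact: cvg_snd|exact: cvg_fst].
have c2 : {for q0, continuous (fun q => ham_vf H (f q.2))}.
  by apply: (@continuous_comp _ _ _ snd (ham_vf H \o f)); [exact: cvg_snd|].
have cG : (fun q => q.2.1 + q.1 *: ham_vf H (f q.2)) @ q0 --> x.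
  rewrite -[X in _ --> X]addr0 -(scale0r (ham_vf H (f (x, y)))).
  by apply: cvgD; [exact: c1|apply: cvgZ; [exact: cvg_fst|exact: c2]].
exact: (cG _ (open_nbhs_nbhs (conj oU Ux))).
Qed.

Lemma ham_vf_is_diff (R : realType) (n : nat) (U : set 'cV[R]_(n + n))
    (H : 'cV[R]_(n + n) -> R)
    (z : 'cV[R]_(n + n)) : hamiltonian U H -> U z ->
  is_diff z (ham_vf H)
    (fun w => (symplJ R n *m partial_mx (gradient H) z) *m w).
Proof.
move=> hH Uz; have [_ /is_diff_partial_mx dg] := hH z Uz.
have dJ := is_diff_mulmx _ _ _ (symplJ R n) (gradient H z).
apply: (@is_diff_eq _ _ _ (ham_vf H) _ _ _ (is_diff_comp dg dJ)).
by apply/funext => w /=; rewrite mulmxA.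
Qed.

(** Applied to [f] with one argument frozen, this yields the terms [h J S B] and [h J S C] of the
    linearized rule. *)
Lemma is_diff_scaled_comp (R : realType) (d p : nat) (X : 'cV[R]_d -> 'cV[R]_d)
    (g : 'cV[R]_p -> 'cV[R]_d) (w : 'cV[R]_p) (M : 'M[R]_d) (h : R) :
  is_diff (g w) X (fun v => M *m v) -> differentiable g w ->
  is_diff w (fun v => h *: X (g v))
    (fun v => (h *: (M *m partial_mx g w)) *m v).
Proof.
move=> dX /is_diff_partial_mx dg.
have dXg : is_diff w (X \o g) (fun v => M *m (partial_mx g w *m v)).
  exact: is_diff_comp.
apply: (@is_diff_eq _ _ _ (h *: (X \o g)) _ _ _ (is_diffZ h dXg)).
by apply/funext => v; rewrite /= fctE -scalemxAl mulmxA.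
Qed.

Theorem proposition2p1 (R : realType) (n : nat)
    (U : set 'cV[R]_(n + n)) (U_open : open U)
    (U_convex : convex_set (U : set (convex_lmodType 'cV[R]_(n + n))))
    (H : 'cV[R]_(n + n) -> R) (H_ham : hamiltonian U H)
    (f : 'cV[R]_(n + n) * 'cV[R]_(n + n) -> 'cV[R]_(n + n))
    (f_U : forall x y, U x -> U y -> U (f (x, y)))
    (f_diff : forall x y, U x -> U y -> differentiable f (x, y))
    (zk zk1 zbar : 'cV[R]_(n + n)) (zk_U : U zk) (zk1_U : U zk1)
    (zbar_U : U zbar) (zbarE : zbar = f (zk, zk1))
    (B C : 'M[R]_(n + n))
    (BE : B = partial_mx (fun x => f (x, zk1)) zk)
    (CE : C = partial_mx (fun y => f (zk, y)) zk1)
    (condi : B + C = 1%:M)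
    (condii : B *m symplJ R n = symplJ R n *m C^T) :
  implicit_symplectic_integrator U
    (fun K h p => p.1 + h *: ham_vf K (f p)) H zk zk1.
Proof.
have df := f_diff _ _ zk_U zk1_U.
set J := symplJ R n in condii *; pose S := partial_mx (gradient H) zbar.
have dX : is_diff (f (zk, zk1)) (ham_vf H) (fun v => (J *m S) *m v).
  by rewrite -zbarE; exact: ham_vf_is_diff H_ham zbar_U.
have dfB : differentiable (fun x => f (x, zk1)) zk.
  exact: (@differentiable_comp _ _ _ _ (fun x => (x, zk1)) f).
have dfC : differentiable (fun y => f (zk, y)) zk1.
  exact: (@differentiable_comp _ _ _ _ (fun y => (zk, y)) f).
pose Psi h := implicit_rule (fun p => p.1 + h *: ham_vf H (f p)).
have A1E h : rule_A1 (Psi h) zk zk1 = 1%:M - h *: (J *m S *m C).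
  rewrite CE; apply: partial_mx_is_diff.
  have dXC := is_diff_scaled_comp _ _ _ _ (fun y => f (zk, y)) _ _ h dX dfC.
  have dx := is_diffB (is_diff_id zk1) (is_diffD (is_diff_cst zk zk1) dXC).
  apply: (is_diff_eq dx); apply/funext => v.
  by rewrite !fctE /= add0r mulmxBl mul1mx.
have A2E h : rule_A2 (Psi h) zk zk1 = 1%:M + h *: (J *m S *m B).
  (* [rule_A2] carries a minus sign, so the Jacobian to be computed is [- (1 + h J S B)]. *)
  rewrite BE -[RHS]opprK; congr (- _); apply: partial_mx_is_diff.
  have dXB := is_diff_scaled_comp _ _ _ _ (fun x => f (x, zk1)) _ _ h dX dfB.
  have dx := is_diffB (is_diff_cst zk1 zk) (is_diffD (is_diff_id zk) dXB).
  apply: (is_diff_eq dx); apply/funext => v.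
  by rewrite !fctE /= add0r mulNmx mulmxDl mul1mx.
(* Only invertibility of [A1] is asked of [h], so this serves both the small stepsizes and the
   clause on all admissible ones. *)
have symp h : rule_A1 (Psi h) zk zk1 \in unitmx ->
    symplectic_rule (Psi h) zk zk1.
  move=> A1u; split=> //.
    have dpr1 (p : 'cV[R]_(n + n) * 'cV[R]_(n + n)) : differentiable fst p.
      by apply: linear_differentiable => q; exact: cvg_fst.
    have dpr2 (p : 'cV[R]_(n + n) * 'cV[R]_(n + n)) : differentiable snd p.
      by apply: linear_differentiable => q; exact: cvg_snd.
    (* The rule takes [(z_{k+1}, z_k)] while the scheme takes [(z_k, z_{k+1})], whence the swap. *)
    have dsw : differentiable
        (fun p : 'cV[R]_(n + n) * 'cV[R]_(n + n) => (p.2, p.1)) (zk1, zk).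
      exact: differentiable_pair.
    apply: differentiableB => //; apply: differentiableD => //.
    apply: (@differentiableZ _ _ _ (ham_vf H \o f \o (fun p => (p.2, p.1)))).
    by apply: differentiable_comp => //; exact: differentiable_comp.
  rewrite /amplification_mx A2E; rewrite A1E in A1u *.
  apply: cayley_symplectic condi condii A1u.
  - exact: trmx_symplJ.
  - exact: symplJ_sqr.
  - exact: hessian_sym U_open H_ham zbar_U.
split=> //.
- exact: ham_vf_step_smooth.
- exact: ham_vf_step_valued_in.
- apply: filterS (unitmx_near0 _ _ (J *m S *m C)) => h.
  by rewrite -A1E; exact: symp.
Qed.
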